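(* Let $1\le p<\infty$ and let $X$ be a real Banach space. If $F(X)$ has the $p$-approximation property, then $X$ has the $p$-approximation property, and further $X$ has the Lipschitz $p$-approximation property.
   Context: $Lip_0(X,Y)$ is the space of Lipschitz maps $f:X\to Y$ with $f(0)=0$; $X^{\#}=Lip_0(X,\mathbb{R})$ with the best-Lipschitz-constant norm. The Lipschitz-free space is $F(X)=\overline{\mathrm{span}}^{\|\cdot\|}\{\delta_x:x\in X\}\subset (X^{\#})^*$, where $\delta_x(f)=f(x)$. $Lip_{0\mathcal{F}}(X,X)$ is the set of $f\in Lip_0(X,X)$ whose range spans a finite-dimensional subspace. A set $K\subset E$ in a Banach space is relatively $p$-compact if there is a sequence $(e_n)$ in $E$ with $\sum_n\|e_n\|^p<\infty$ and $K\subset\{\sum_n a_ne_n:(a_n)\in B_{\ell_{p'}}\}$, $p'$ the conjugate exponent of $p$; a $p$-compact set is a closed relatively $p$-compact set. $E$ has the $p$-approximation property if for every $p$-compact $K\subset E$ and $\epsilon>0$ there is a bounded finite-rank linear operator $T$ on $E$ with $\|Tx-x\|<\epsilon$ for all $x\in K$. $X$ has the Lipschitz $p$-approximation property if $Id_X\in\overline{Lip_{0\mathcal{F}}(X,X)}^{\tau_p}$, where $\tau_p$ is the topology of uniform convergence on $p$-compact subsets of $X$. *)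

(* Defs.v *)
From HB Require Import structures.
From mathcomp Require Import all_boot all_order all_algebra.
From mathcomp Require Import all_classical all_reals all_analysis.

Set Implicit Arguments.
Unset Strict Implicit.
Unset Printing Implicit Defensive.

Import Order.TTheory GRing.Theory Num.Theory.
Import numFieldNormedType.Exports.

Local Open Scope classical_set_scope.
Local Open Scope ring_scope.

Section LinearSpan.
Context {R : realType} {E : lmodType R}.
Implicit Types A W : set E.

Definition is_subspace W :=
  W 0 /\ forall (a : R) u v, W u -> W v -> W (a *: u + v).

Definition linear_span A : set E := smallest is_subspace A.

Definition finite_dimensional W := exists s : seq E, W = linear_span [set` s].

Lemma linear_span_subspace A : is_subspace (linear_span A).
Proof.
split=> [W [[W0 _] _] //|a u v Au Av W hW].
by case: (hW) => -[_ WD] _; apply: WD; [exact: Au | exact: Av].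
Qed.

End LinearSpan.

Definition bounded_operator (R : realType) (E G : normedModType R)
    (T : E -> G) :=
  exists M : R, forall x, `|T x| <= M * `|x|.

(** Both the best Lipschitz constant and the operator norm are the least
    [k >= 0] such that [`|ev v i| <= k * h i] for all [i], with [ev] linear
    in [v].  The norm axioms are proved once in this generality. *)
Section BestConstant.
Variables (R : realType) (V : lmodType R) (W : normedModType R) (I : Type).
Variables (ev : V -> I -> W) (h : I -> R) (B : V -> set R).
Hypothesis h_ge0 : forall i, 0 <= h i.
Hypothesis ev_lin : forall a u v i, ev (a *: u + v) i = a *: ev u i + ev v i.
Hypothesis ev_inj : forall v, (forall i, ev v i = 0) -> v = 0.
Hypothesis BE :
  forall v k, B v k <-> 0 <= k /\ forall i, `|ev v i| <= k * h i.
Hypothesis B_neq0 : forall v, B v !=set0.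

Let B_lb v : has_lbound (B v).
Proof. by exists 0 => k /BE[]. Qed.

Lemma best_constant_ge0 v : 0 <= inf (B v).
Proof. by apply: lb_le_inf => // k /BE[]. Qed.

Lemma best_constant_le v k : 0 <= k -> (forall i, `|ev v i| <= k * h i) ->
  inf (B v) <= k.
Proof. by move=> k0 vk; apply: ge_inf => //; apply/BE. Qed.

Lemma best_constantP v i : `|ev v i| <= inf (B v) * h i.
Proof.
have := h_ge0 i; rewrite le_eqVlt => /orP[/eqP h0|h_gt0].
  have [k /BE[_ /(_ i)]] := B_neq0 v.
  by rewrite -h0 !mulr0.
rewrite -ler_pdivrMr//; apply: lb_le_inf => // k /BE[_ /(_ i)].
by rewrite ler_pdivrMr.
Qed.

Let ev0 i : ev 0 i = 0.
Proof. by have := ev_lin (-1) 0 0 i; rewrite scaler0 addr0 scaleN1r addNr. Qed.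

Lemma best_constantD u v : inf (B (u + v)) <= inf (B u) + inf (B v).
Proof.
apply: best_constant_le => [|i]; first by rewrite addr_ge0// best_constant_ge0.
have := ev_lin 1 u v i; rewrite !scale1r => ->.
by rewrite mulrDl (le_trans (ler_normD _ _))// lerD// best_constantP.
Qed.

Let best_constantZ_le a v : inf (B (a *: v)) <= `|a| * inf (B v).
Proof.
apply: best_constant_le => [|i]; first by rewrite mulr_ge0// best_constant_ge0.
have := ev_lin a v 0 i; rewrite addr0 ev0 addr0 => ->.
by rewrite normrZ -mulrA ler_wpM2l// best_constantP.
Qed.

Lemma best_constantZ a v : inf (B (a *: v)) = `|a| * inf (B v).
Proof.
apply/le_anti; rewrite best_constantZ_le/=.
have [->|a0] := eqVneq a 0.
  by rewrite normr0 mul0r best_constant_ge0.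
have := best_constantZ_le a^-1 (a *: v).
rewrite scalerA mulVf// scale1r normfV.
by rewrite ler_pdivlMl// normr_gt0.
Qed.

Lemma best_constant_eq0 v : inf (B v) = 0 -> v = 0.
Proof.
move=> v0; apply: ev_inj => i; apply/eqP; rewrite -normr_le0.
by have := best_constantP v i; rewrite v0 mul0r.
Qed.

End BestConstant.

Section LipZero.
Context {R : realType} (X Y : normedModType R).

Definition lip0 : {pred X -> Y} :=
  [pred f : X -> Y | `[< lipschitz f /\ f 0 = 0 >]].

Record Lip0 := MkLip0 { lip0_fun :> X -> Y; lip0_funP : lip0_fun \in lip0 }.

HB.instance Definition _ := [isSub for lip0_fun].
HB.instance Definition _ := [Choice of Lip0 by <:].

Lemma lip0P (f : X -> Y) : f \in lip0 <->
  (exists2 k : R, 0 <= k & forall x y, `|f x - f y| <= k * `|x - y|) /\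
  f 0 = 0.
Proof.
split=> [/asboolP[flip f0]|[[k k0 fk] f0]].
  split=> //; have [M [Mr lipM]] := flip.
  exists (Num.max 0 (M + 1)); first by rewrite le_max lexx.
  move=> x y; have := lipM (Num.max 0 (M + 1)).
  rewrite lt_max ltrDl ltr01 orbT => /(_ isT (x, y)) /=; exact.
apply/asboolP; split=> //; apply: (@klipschitzW _ _ _ k).
  exact: (@globally_properfilter _ _ (0, 0)).
by move=> [x y] _; exact: fk.
Qed.

Fact lip0_submod_closed : submod_closed lip0.
Proof.
split.
  apply/lip0P; split=> //; exists 0 => // x y.
  by rewrite subrr normr0 mul0r.
move=> a f g /lip0P[[k k0 fk] f0] /lip0P[[l l0 gl] g0]; apply/lip0P; split.
  exists (`|a| * k + l) => [|x y]; first by rewrite addr_ge0// mulr_ge0.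
  have -> : (a *: f + g) x - (a *: f + g) y
           = a *: (f x - f y) + (g x - g y).
    by rewrite scalerBr addrACA -opprD.
  rewrite (le_trans (ler_normD _ _))// mulrDl lerD// normrZ -mulrA.
  by rewrite ler_wpM2l.
by rewrite /GRing.add /= /GRing.scale /= f0 g0 scaler0 addr0.
Qed.

HB.instance Definition _ :=
  GRing.isSubmodClosed.Build R (X -> Y) lip0 lip0_submod_closed.
HB.instance Definition _ := [SubChoice_isSubLmodule of Lip0 by <:].

Definition best_lipschitz_constant (f : Lip0) : R :=
  inf [set k | 0 <= k /\ k.-lipschitz f].

Fact lip0_boundE (f : Lip0) k : (0 <= k /\ k.-lipschitz f) <->
  0 <= k /\ forall xy : X * X, `|f xy.1 - f xy.2| <= k * `|xy.1 - xy.2|.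
Proof.
by split=> -[k0 fk]; split=> // -[x y]; [exact: fk|move=> _; exact: fk (x, y)].
Qed.

Fact lip0_bound_neq0 (f : Lip0) : [set k | 0 <= k /\ k.-lipschitz f] !=set0.
Proof.
have /lip0P[[k k0 fk] _] := lip0_funP f.
by exists k; apply/lip0_boundE; split=> // -[x y]; exact: fk.
Qed.

Fact lip0_ev_lin (a : R) (f g : Lip0) (xy : X * X) :
  (a *: f + g) xy.1 - (a *: f + g) xy.2 =
  a *: (f xy.1 - f xy.2) + (g xy.1 - g xy.2).
Proof. by rewrite scalerBr addrACA -opprD. Qed.

Fact lip0_ev_inj (f : Lip0) : (forall xy : X * X, f xy.1 - f xy.2 = 0) -> f = 0.
Proof.
move=> f_cst; apply/val_inj/funext => x.
have /lip0P[_ f0] := lip0_funP f.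
by have /= := f_cst (x, 0); rewrite f0 subr0.
Qed.

HB.instance Definition _ := Lmodule_isNormed.Build R Lip0
  (best_constantD (fun=> normr_ge0 _) lip0_ev_lin lip0_boundE lip0_bound_neq0)
  (best_constantZ (fun=> normr_ge0 _) lip0_ev_lin lip0_boundE lip0_bound_neq0)
  (best_constant_eq0 (fun=> normr_ge0 _) lip0_ev_inj lip0_boundE
    lip0_bound_neq0).

Lemma lip0_normE (f : Lip0) : `|f| = best_lipschitz_constant f.
Proof. by []. Qed.

End LipZero.

Arguments lip0 {R} X Y.

Definition lip0_finite_rank {R : realType} (X : normedModType R) :
    set (X -> X) :=
  [set f | f \in lip0 X X /\ finite_dimensional (linear_span (range f))].

Arguments lip0_finite_rank {R} X.

Section TopologicalDual.
Context {R : realType} (E : normedModType R).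

Definition dual : {pred E -> R^o} :=
  [pred phi : E -> R^o |
    `[< (forall (a : R) u v, phi (a *: u + v) = a *: phi u + phi v) /\
        bounded_operator phi >]].

Record Dual :=
  MkDual { dual_fun :> E -> R^o; dual_funP : dual_fun \in dual }.

HB.instance Definition _ := [isSub for dual_fun].
HB.instance Definition _ := [Choice of Dual by <:].

Lemma dualP (phi : E -> R^o) : phi \in dual <->
  (forall (a : R) u v, phi (a *: u + v) = a *: phi u + phi v) /\
  (exists2 k : R, 0 <= k & forall x, `|phi x| <= k * `|x|).
Proof.
split=> [/asboolP[lphi [M phiM]]|[lphi [k k0 phik]]].
  split=> //; exists `|M| => // x.
  by rewrite (le_trans (phiM x))// ler_wpM2r// ler_norm.
by apply/asboolP; split=> //; exists k.
Qed.

Fact dual_submod_closed : submod_closed dual.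
Proof.
split.
  apply/dualP; split=> [a u v|]; first by rewrite /= scaler0 addr0.
  by exists 0 => // x; rewrite normr0 mul0r.
move=> a f g /dualP[lf [k k0 fk]] /dualP[lg [l l0 gl]].
apply/dualP; split=> [b u v|].
  rewrite /GRing.add /= /GRing.scale /= lf lg.
  by rewrite /GRing.scale /= !mulrDr !mulrA (mulrC b a) addrACA.
exists (`|a| * k + l) => [|x]; first by rewrite addr_ge0// mulr_ge0.
rewrite (le_trans (ler_normD _ _))// mulrDl lerD// normrZ -mulrA.
by rewrite ler_wpM2l.
Qed.

HB.instance Definition _ :=
  GRing.isSubmodClosed.Build R (E -> R^o) dual dual_submod_closed.
HB.instance Definition _ := [SubChoice_isSubLmodule of Dual by <:].

Definition dual_norm (phi : Dual) : R :=
  inf [set k | 0 <= k /\ forall x, `|phi x| <= k * `|x|].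

Fact dual_boundE (phi : Dual) (k : R) :
  (0 <= k /\ forall x, `|phi x| <= k * `|x|) <->
  0 <= k /\ forall x, `|phi x| <= k * `|x|.
Proof. by []. Qed.

Fact dual_bound_neq0 (phi : Dual) :
  [set k | 0 <= k /\ forall x, `|phi x| <= k * `|x|] !=set0.
Proof. by have /dualP[_ [k k0 phik]] := dual_funP phi; exists k. Qed.

Fact dual_ev_lin (a : R) (f g : Dual) (x : E) :
  (a *: f + g) x = a *: f x + g x.
Proof. by []. Qed.

Fact dual_ev_inj (f : Dual) : (forall x, f x = 0) -> f = 0.
Proof. by move=> f0; exact/val_inj/funext. Qed.

HB.instance Definition _ := Lmodule_isNormed.Build R Dual
  (best_constantD (@normr_ge0 _ E) dual_ev_lin dual_boundE dual_bound_neq0)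
  (best_constantZ (@normr_ge0 _ E) dual_ev_lin dual_boundE dual_bound_neq0)
  (best_constant_eq0 (@normr_ge0 _ E) dual_ev_inj dual_boundE dual_bound_neq0).

Lemma dual_normE (phi : Dual) : `|phi| = dual_norm phi.
Proof. by []. Qed.

Lemma dual_le_norm (phi : Dual) x : `|phi x| <= `|phi| * `|x|.
Proof.
exact: (best_constantP (@normr_ge0 _ E) dual_boundE dual_bound_neq0).
Qed.

Lemma dual_norm_le (phi : Dual) k :
  0 <= k -> (forall x, `|phi x| <= k * `|x|) -> `|phi| <= k.
Proof. exact: (best_constant_le dual_boundE). Qed.

Fact dual_complete (F : set_system Dual) :
  ProperFilter F -> cauchy F -> cvg F.
Proof.
move=> FF /cauchyP F_cauchy.
have Fball (e : R) : 0 < e ->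
    exists phi : Dual, F [set psi | `|phi - psi| < e].
  move=> e0; have [phi Fphi] := F_cauchy _ e0.
  by exists phi; move: Fphi; rewrite -ball_normE.
have ev_cvg (x : E) : cvg ((fun phi : Dual => phi x) @ F).
  apply: cauchy_cvg; apply/cauchyP => e e0.
  have e1 : 0 < e / (`|x| + 1) by rewrite divr_gt0// ltr_wpDl.
  have [phi Fphi] := Fball _ e1.
  exists (phi x); rewrite -ball_normE /=; apply: filterS Fphi => psi /= phipsi.
  apply: le_lt_trans (dual_le_norm (phi - psi) x) _.
  rewrite ltr_pdivlMr ?ltr_wpDl// in phipsi.
  by apply: le_lt_trans phipsi; rewrite ler_wpM2l// lerDl.
pose L (x : E) : R^o := lim ((fun phi : Dual => phi x) @ F).
have L_cvg (x : E) : (fun phi : Dual => phi x) @ F --> L x by exact: ev_cvg.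
have L_lin (a : R) u v : L (a *: u + v) = a *: L u + L v.
  apply: (@cvg_lim R^o) => //.
  have -> : (fun phi : Dual => phi (a *: u + v)) =
            (fun phi : Dual => a *: phi u + phi v).
    by apply/funext => phi; have /dualP[-> _] := dual_funP phi.
  by apply: cvgD => //; exact: cvgZr.
have L_near e (phi : Dual) : F [set psi | `|phi - psi| < e] ->
    forall x, `|phi x - L x| <= e * `|x|.
  move=> Fphi x.
  have c : (fun psi : Dual => `|phi x - psi x|) @ F --> `|phi x - L x|.
    by apply: cvg_norm; apply: cvgB; [exact: cvg_cst|exact: L_cvg].
  rewrite -(cvg_lim _ c)//; apply: limr_le.
    by apply/cvg_ex; exists `|phi x - L x|.
  apply: filterS Fphi => psi /= /ltW phipsi.
  by rewrite (le_trans (dual_le_norm (phi - psi) x))// ler_wpM2r.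
have LP : L \in dual.
  apply/dualP; split=> //; have [phi Fphi] := Fball _ ltr01.
  exists (`|phi| + 1) => [|x]; first by rewrite addr_ge0.
  rewrite -(subKr (phi x) (L x)) (le_trans (ler_normB _ _))// mulrDl.
  by rewrite lerD ?dual_le_norm// L_near.
apply/cvg_ex; exists (MkDual LP); apply/cvgrPdist_lt => e e0.
have e2 : 0 < e / 2 by rewrite divr_gt0.
have [phi Fphi] := Fball _ e2.
apply: filterS (Fphi) => psi /= phipsi.
rewrite (splitr e) -[_ - psi](subrKA phi).
rewrite (le_lt_trans (ler_normD _ _))//.
rewrite ler_ltD// distrC.
by apply: dual_norm_le => [|x]; [exact: ltW | exact: L_near].
Qed.

HB.instance Definition _ := Uniform_isComplete.Build Dual dual_complete.

End TopologicalDual.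

Arguments dual {R} E.

Lemma closure_normP (R : realType) (E : normedModType R) (A : set E) x :
  closure A x <-> forall e : R, 0 < e -> exists2 y, A y & `|x - y| < e.
Proof.
split=> [clA e e0|clA B /nbhs_normP[e e0 eB]].
  have [y [Ay xy]] := clA _ (nbhsx_ballx x e e0).
  by exists y => //; move: xy; rewrite -ball_normE.
by have [y Ay xy] := clA e e0; exists y; split=> //; exact: eB.
Qed.

Section LipschitzFree.
Context {R : realType} (X : normedModType R).
Local Notation "X ^#" := (Lip0 X R^o) (at level 2).

Lemma lip0_le_norm (f : X^#) x : `|f x| <= `|f| * `|x|.
Proof.
have /lip0P[_ f0] := lip0_funP f.
have := best_constantP (fun=> normr_ge0 _) (@lip0_boundE _ _ _)
  (@lip0_bound_neq0 _ _ _) f (x, 0).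
by rewrite /= f0 !subr0.
Qed.

Fact evaluation_dual (x : X) : (fun f : X^# => f x) \in dual X^#.
Proof.
apply/dualP; split=> //; exists `|x| => // f.
by rewrite mulrC lip0_le_norm.
Qed.

Definition evaluation (x : X) : Dual X^# := MkDual (evaluation_dual x).

Definition lipschitz_free : {pred Dual X^#} :=
  [pred mu | `[< closure (linear_span (range evaluation)) mu >]].

Record LipschitzFree := MkLipschitzFree {
  free_val :> Dual X^#; free_valP : free_val \in lipschitz_free }.

HB.instance Definition _ := [isSub for free_val].
HB.instance Definition _ := [Choice of LipschitzFree by <:].

Fact lipschitz_free_submod_closed : submod_closed lipschitz_free.
Proof.
have [S0 SD] := linear_span_subspace (range evaluation).
split=> [|a u v /asboolP/closure_normP clu /asboolP/closure_normP clv].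
  by apply/asboolP; exact: subset_closure.
apply/asboolP/closure_normP => e e0.
have e1 : 0 < e / 2 / (`|a| + 1) by rewrite !divr_gt0// ltr_wpDl.
have e2 : 0 < e / 2 by rewrite divr_gt0.
have [u' Su uu'] := clu _ e1.
have [v' Sv vv'] := clv _ e2.
exists (a *: u' + v'); first exact: SD.
have -> : a *: u + v - (a *: u' + v') = a *: (u - u') + (v - v').
  by rewrite scalerBr addrACA -opprD.
rewrite (le_lt_trans (ler_normD _ _))// (splitr e) ler_ltD// normrZ.
rewrite ltr_pdivlMr ?ltr_wpDl// in uu'.
apply: le_trans (ltW uu').
by rewrite mulrC ler_wpM2l// lerDl.
Qed.

HB.instance Definition _ := GRing.isSubmodClosed.Build R (Dual X^#)
  lipschitz_free lipschitz_free_submod_closed.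
HB.instance Definition _ := [SubChoice_isSubLmodule of LipschitzFree by <:].

Let free_norm (mu : LipschitzFree) : R := `|free_val mu|.

Fact free_normD mu nu : free_norm (mu + nu) <= free_norm mu + free_norm nu.
Proof. exact: ler_normD. Qed.

Fact free_normZ a mu : free_norm (a *: mu) = `|a| * free_norm mu.
Proof. exact: normrZ. Qed.

Fact free_norm_eq0 mu : free_norm mu = 0 -> mu = 0.
Proof. by move=> /normr0_eq0 mu0; exact: val_inj. Qed.

HB.instance Definition _ :=
  Lmodule_isNormed.Build R LipschitzFree free_normD free_normZ free_norm_eq0.

Lemma free_normE (mu : LipschitzFree) : `|mu| = `|free_val mu|.
Proof. by []. Qed.

Fact free_complete (F : set_system LipschitzFree) :
  ProperFilter F -> cauchy F -> cvg F.
Proof.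
move=> FF /cauchyP F_cauchy.
have vF_cvg : cvg (free_val @ F).
  apply: cauchy_cvg; apply/cauchyP => e e0.
  have [mu Fmu] := F_cauchy e e0; exists (free_val mu).
  by apply: (@filterS _ F _ _ _ _ Fmu) => nu; rewrite -!ball_normE.
have vF_lim : free_val @ F --> lim (free_val @ F) by [].
have LP : lim (free_val @ F) \in lipschitz_free.
  apply/asboolP; apply: (@closed_cvg _ _ _ _ _ _ (@closed_closure _ _) _ _ vF_lim).
  by apply: nearW => mu; have /asboolP := free_valP mu.
apply/cvg_ex; exists (MkLipschitzFree LP); apply/cvgrPdist_lt => e e0.
by move/cvgrPdist_lt : vF_lim => /(_ e e0).
Qed.

HB.instance Definition _ := Uniform_isComplete.Build LipschitzFree free_complete.

End LipschitzFree.

Section PCompact.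
Context {R : realType} (p : R).

(** For [p = 1] the conjugate exponent is [+oo] and this is the unit ball of
    l^oo (not of c_0). *)
Definition lp'_ball : set (nat -> R) :=
  [set a | ('N[counting]_(hoelder_conjugate p%:E)[EFin \o a] <= 1)%E].

Section Sets.
Context {E : normedModType R}.

Definition relatively_p_compact (K : set E) :=
  exists2 e : nat -> E,
    (\sum_(0 <= n <oo) (`|e n| `^ p)%:E < +oo)%E &
    K `<=` [set x | exists2 a, lp'_ball a &
                    series (fun n => a n *: e n) @ \oo --> x].

Definition p_compact (K : set E) := closed K /\ relatively_p_compact K.

End Sets.

Definition p_approximation_property (E : completeNormedModType R) :=
  forall (K : set E) (eps : R), p_compact K -> 0 < eps ->
  exists T : {linear E -> E},
    [/\ bounded_operator T, finite_dimensional (range T) &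
        forall x, K x -> `|T x - x| < eps].

(** The closure is taken among all maps [X -> X]; since the identity and the
    approximating maps lie in Lip_0(X, X), this agrees with the closure in
    Lip_0(X, X) for the induced topology. *)
Definition lipschitz_p_approximation_property (X : completeNormedModType R) :=
  closure (lip0_finite_rank X : set {family @p_compact X, X -> X}) idfun.

End PCompact.

(* Main.v *)
Require Import Defs.
From HB Require Import structures.
From mathcomp Require Import all_boot all_order all_algebra.
From mathcomp Require Import all_classical all_reals all_analysis.
From mathcomp Require Import ess_sup_inf.

(** The barycenter map [beta : F(X) -> X] is the linear contraction that sends
    [delta x] to [x], so [delta] is an isometric but nonlinear section of it.  If
    [beta] had a linear isometric section [U], then a finite-rank operator [T] on
    [F(X)] close to the identity on [U(K)] would give [beta \o T \o U], close to
    the identity on [K].  Such a global [U] need not exist when [X] is not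
    separable, but a p-compact set lies in the closed span of a sequence [e], and
    over that span a linear section does exist ([separable_linear_section]); the
    resulting finite-rank operator is extended to [X] by the Hahn-Banach theorem
    ([p_approximation_property_contraction]).

    The linear section is a derivative.  The map [delta] is replaced by an average
    [G] of its translates along small multiples of all the [e n].  Averaging
    keeps [G] nonexpansive and keeps [beta (G x) - x] constant, and it makes [G]
    differentiable at [0] along each [e n], with estimates that are locally
    uniform in the base point; hence the derivative is linear and contractive on
    the span of the [e n], and [beta] inverts it.  No integral is needed: the
    average over a segment is an infinite composition of the midpoint averages
    [g |-> (g x + g (x + h)) / 2] along [h = w/2, w/4, w/8, ...], and the halving
    of increments in [increment_lipschitz_halve] accumulates to
    differentiability ([smoothing_exists], [derivative_at0_exists]).

    The approximating operators on [X] are linear and bounded, hence Lipschitz,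
    so the second property follows from the first once a basic neighbourhood of
    the identity, which involves finitely many p-compact sets, is reduced to a
    single one: p-compact sets are closed under finite unions ([p_compactU],
    [lipschitz_p_approximation_of_linear]). *)

Set Implicit Arguments.
Unset Strict Implicit.
Unset Printing Implicit Defensive.

Import Order.TTheory GRing.Theory Num.Theory.
Import numFieldNormedType.Exports.
Local Open Scope classical_set_scope.
Local Open Scope ring_scope.

(** * The Hahn-Banach theorem *)

Section HahnBanach.
Context {R : realType} {E : normedModType R} (C : R).
Hypothesis C_ge0 : 0 <= C.
Implicit Types A B : set (E * R^o).

Let good A := is_subspace A /\ forall x r, A (x, r) -> r <= C * `|x|.

(** The value [c] at a new point [x] has to satisfy [r + c <= C |y + x|] and
    [r - c <= C |y - x|] for every point [(y, r)] of the graph; the triangle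
    inequality makes these lower and upper bounds compatible, and homogeneity
    reduces all multiples of [x] to these two. *)
Lemma bounded_graph_extend A (x : E) : good A ->
  exists B, [/\ good B, A `<=` B & exists c, B (x, c)].
Proof.
move=> [[A0 AD] AC].
have AZ a y r : A (y, r) -> A (a *: y, a * r).
  by move=> Ayr; have := AD a _ _ Ayr A0; rewrite addr0.
have AA y r y' r' : A (y, r) -> A (y', r') -> A (y + y', r + r').
  by move=> Ay Ay'; have := AD 1 _ _ Ay Ay'; rewrite scale1r.
pose S := [set s | exists y r, A (y, r) /\ s = r - C * `|y - x|].
have S_ub y r : A (y, r) -> ubound S (C * `|y + x| - r).
  move=> Ayr _ [y' [r' [Ayr' ->]]].
  rewrite lerBrDr addrAC lerBlDr (le_trans (AC _ _ (AA _ _ _ _ Ayr' Ayr)))//.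
  rewrite -mulrDr ler_wpM2l//.
  have -> : y' + y = (y + x) + (y' - x) by rewrite addrACA subrr addr0 addrC.
  exact: ler_normD.
have S0 : S !=set0 by exists (0 - C * `|0 - x|), 0, 0.
have S_sup : has_sup S by split => //; exists (C * `|0 + x| - 0); exact: S_ub.
pose c := sup S.
have c_ub y r : A (y, r) -> r + c <= C * `|y + x|.
  by move=> Ayr; rewrite addrC -lerBrDr ge_sup//; exact: S_ub.
have c_lb y r : A (y, r) -> r - c <= C * `|y - x|.
  move=> Ayr; rewrite lerBlDr addrC -lerBlDr.
  by apply: sup_upper_bound => //; exists y, r.
exists [set z | exists y r t, A (y, r) /\ z = (y + t *: x, r + t * c)].
split.
- split; first split.
  + by exists 0, 0, 0; rewrite !(scale0r, mul0r, addr0).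
  + move=> a _ _ [y [r [t [Ayr ->]]]] [y' [r' [t' [Ayr' ->]]]].
    exists (a *: y + y'), (a * r + r'), (a * t + t').
    split; first exact: (AD a (y, r) (y', r')).
    congr pair => /=.
      by rewrite scalerDr scalerDl scalerA addrACA.
    by rewrite /GRing.scale/= mulrDr mulrDl mulrA addrACA.
  + move=> _ _ [y [r [t [Ayr [-> ->]]]]].
    have [t0|t0|->] := ltgtP t 0; last first.
    * by rewrite mul0r scale0r !addr0 AC.
    * have := c_ub _ _ (AZ t^-1 _ _ Ayr).
      rewrite -(ler_pM2l t0) mulrDr mulrA divff ?gt_eqF// mul1r.
      move=> /le_trans; apply.
      rewrite mulrCA ler_wpM2l// -[X in X * _]gtr0_norm// -normrZ.
      by rewrite scalerDr scalerA divff ?gt_eqF// scale1r.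
    * have s0 : 0 < - t by rewrite oppr_gt0.
      have := c_lb _ _ (AZ (- t)^-1 _ _ Ayr).
      rewrite -(ler_pM2l s0) mulrBr mulrA divff ?gt_eqF// mul1r mulNr opprK.
      move=> /le_trans; apply.
      rewrite mulrCA ler_wpM2l// -[X in X * _]gtr0_norm// -normrZ.
      by rewrite scalerBr scalerA divff ?gt_eqF// scale1r scaleNr opprK.
- by move=> [y r] Ayr; exists y, r, 0; rewrite scale0r mul0r !addr0.
- by exists c, 0, 0, 1; rewrite scale1r mul1r !add0r.
Qed.

(** A partial linear functional is represented by its graph, a subspace of
    [E * R]; the bound makes such a graph single-valued.  Thus no subspace type
    or partial function is needed, and a functional on the image of a subspace
    under an isometry is as easy to write down as any other. *)
Lemma hahn_banach A : is_subspace A ->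
    (forall x r, A (x, r) -> r <= C * `|x|) ->
  exists phi : Dual E, (forall x, `|phi x| <= C * `|x|) /\
    forall x r, A (x, r) -> phi x = r.
Proof.
move=> sA AC.
(* Joining [A] to every member of a chain makes the empty chain harmless. *)
pose P B := good (B `|` A).
have [F FP Ftot|M [PM Mmax]] := @Zorn_bigcup _ P.
  have pair_in u v : (\bigcup_(X in F) X `|` A) u ->
      (\bigcup_(X in F) X `|` A) v ->
      exists B, [/\ good B, B `<=` \bigcup_(X in F) X `|` A, B u & B v].
    have FA X : F X -> X `|` A `<=` \bigcup_(X in F) X `|` A.
      by move=> FX; apply: setSU => z Xz; exists X.
    move=> [[X FX Xu]|Au] [[Y FY Yv]|Av].
    - have [XY|YX] := Ftot _ _ FX FY.
        exists (Y `|` A); split; [exact: FP|exact: FA|left; exact: XY|by left].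
      exists (X `|` A); split; [exact: FP|exact: FA|by left|left; exact: YX].
    - by exists (X `|` A); split; [exact: FP|exact: FA|left|right].
    - by exists (Y `|` A); split; [exact: FP|exact: FA|right|left].
    - by exists A; split => // z Az; right.
  split; first split.
  - by right; case: sA.
  - move=> a u v Uu Uv; have [B [[[_ BD] _] BU Bu Bv]] := pair_in _ _ Uu Uv.
    by apply: BU; exact: BD.
  - move=> x r Uxr; have [B [[_ BC] _ Bx _]] := pair_in _ _ Uxr Uxr.
    exact: BC.
pose N := M `|` A.
have [[N0 ND] NC] : good N := PM.
have Ntot x : exists c, N (x, c).
  have [B [gB NB [c Bxc]]] := bounded_graph_extend x PM.
  exists c; apply: contrapT => nNxc; apply: (Mmax B).
    split; first by move=> z Mz; apply: NB; left.
    by move=> /(_ _ Bxc) Mxc; apply: nNxc; left.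
  have BA : A `<=` B by move=> z Az; apply: NB; right.
  by rewrite /P setUidl.
have [phi Nphi] := choice Ntot.
have Nabs x r : N (x, r) -> `|r| <= C * `|x|.
  move=> Nxr; rewrite ler_norml NC// andbT lerNl -normrN NC//.
  by have := ND (-1) _ _ Nxr N0; rewrite addr0 !scaleN1r.
have Nuniq x r s : N (x, r) -> N (x, s) -> r = s.
  move=> Nr Ns; have := Nabs _ _ (ND (-1) _ _ Nr Ns).
  rewrite !scaleN1r addNr normr0 mulr0 normr_le0 addrC subr_eq0.
  by move/eqP.
have phi_lin (a : R) u v : phi (a *: u + v) = a *: phi u + phi v :> R^o.
  by apply: Nuniq (Nphi _) _; exact: ND (Nphi u) (Nphi v).
have phiP : (phi : E -> R^o) \in dual E.
  by apply/dualP; split => //; exists C => // x; exact: Nabs.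
exists (MkDual phiP); split => [x|x r Axr]; first exact: Nabs.
by apply: Nuniq (Nphi x) _; right.
Qed.

End HahnBanach.

Lemma norming_functional {R : realType} {E : normedModType R} (z : E) :
  exists phi : Dual E, (forall x, `|phi x| <= `|x|) /\ phi z = `|z|.
Proof.
pose A : set (E * R^o) := [set u | exists t : R, u = (t *: z, t * `|z|)].
have [||phi [phi1 phiA]] := @hahn_banach R E 1 ler01 A.
- split; first by exists 0; rewrite scale0r mul0r.
  move=> a _ _ [s ->] [t ->]; exists (a * s + t).
  congr pair => /=; first by rewrite scalerDl scalerA.
  by rewrite mulrDl -mulrA.
- move=> _ _ [t [-> ->]]; rewrite mul1r normrZ ler_wpM2r//; exact: ler_norm.
exists phi; split => [x|]; first by rewrite -[leRHS]mul1r.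
by apply: phiA; exists 1; rewrite scale1r mul1r.
Qed.

(** * Geometric estimates *)

Lemma halfpow_double {R : realType} n :
  2^-1 ^+ n = 2^-1 ^+ n.+1 + 2^-1 ^+ n.+1 :> R.
Proof. by rewrite exprS mulrC -splitr. Qed.

Lemma halfpow_lt {R : realType} (C e : R) : 0 < e ->
  exists n, C * 2^-1 ^+ n < e.
Proof.
move=> e0; have : (fun n => C * 2^-1 ^+ n) @ \oo --> C * 0.
  apply: cvgM; first exact: cvg_cst.
  by apply: cvg_expr; rewrite gtr0_norm ?invf_lt1// ltr1n.
rewrite mulr0 => /cvgrPdist_lt/(_ e e0)[n _ /(_ n (leqnn n))]/=.
by rewrite sub0r normrN => /(le_lt_trans (ler_norm _)); exists n.
Qed.

Lemma le0_of_halfpow {R : realType} (r C : R) :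
  (forall n, r <= C * 2^-1 ^+ n) -> r <= 0.
Proof.
move=> rC; rewrite leNgt; apply/negP => /(halfpow_lt C)[n].
by rewrite ltNge rC.
Qed.

Lemma cauchy_seq_cvg {R : realType} (V : completeNormedModType R)
    (u : nat -> V) :
  (forall e : R, 0 < e -> exists N, forall n, (N <= n)%N -> `|u N - u n| < e) ->
  exists l : V, u @ \oo --> l.
Proof.
move=> uC; have : cvgn u.
  apply: cauchy_cvg; apply/cauchyP => e /uC[N uN].
  by exists (u N), N => // n /= /uN; rewrite -ball_normE.
by move=> /cvg_ex[l ul]; exists l.
Qed.

Lemma cvg_norm_le {R : realType} (V : normedModType R) (u : nat -> V) (l : V)
    r N :
  u @ \oo --> l -> (forall n, (N <= n)%N -> `|u n| <= r) -> `|l| <= r.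
Proof.
move=> ul ur; have c : (fun n => `|u n|) @ \oo --> `|l| by exact: cvg_norm.
rewrite -(cvg_lim _ c)//; apply: limr_le; last by exists N.
by apply/cvg_ex; exists (`|l|).
Qed.

Lemma geometric_cvg {R : realType} (V : completeNormedModType R) (u : nat -> V)
    (C : R) : 0 <= C ->
  (forall n, `|u n - u n.+1| <= C * 2^-1 ^+ n.+1) ->
  exists l : V, u @ \oo --> l /\ forall n, `|u n - l| <= C * 2^-1 ^+ n.
Proof.
move=> C0 uC.
have uij i k : `|u i - u (i + k)%N| <= C * 2^-1 ^+ i.
  suff : `|u i - u (i + k)%N| <= C * (2^-1 ^+ i - 2^-1 ^+ (i + k)).
    move/le_trans; apply; rewrite ler_wpM2l// gerBl exprn_ge0//.
  elim: k => [|k IH]; first by rewrite addn0 !subrr normr0 mulr0.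
  rewrite -(subrKA (u (i + k)%N)) (le_trans (ler_normD _ _))//.
  have /(lerD IH)/le_trans := uC (i + k)%N; rewrite addnS; apply.
  rewrite -mulrDr ler_wpM2l// -addrA lerD2l.
  by rewrite [in X in - X + _]halfpow_double opprD subrK.
have [l ul] : exists l : V, u @ \oo --> l.
  apply: cauchy_seq_cvg => e /(halfpow_lt C)[N CN]; exists N => n Nn.
  by rewrite -(subnKC Nn) (le_lt_trans (uij _ _)).
exists l; split => // n.
have c : (fun m => u n - u m) @ \oo --> u n - l.
  by apply: cvgB => //; exact: cvg_cst.
by apply: (cvg_norm_le (N := n) c) => m nm; rewrite -(subnKC nm).
Qed.
(** * Finite-dimensional spans *)

Section FiniteSpan.
Context {R : realType} {E : lmodType R}.
Implicit Types (W : set E) (s : seq E).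

Lemma linear_span_sub W A : is_subspace W -> A `<=` W -> linear_span A `<=` W.
Proof. by move=> sW AW; exact: smallest_sub. Qed.

Lemma mem_linear_span (A : set E) : A `<=` linear_span A.
Proof. exact: sub_smallest. Qed.

Lemma linear_span_id W : is_subspace W -> linear_span W = W.
Proof.
move=> sW; apply/seteqP; split; last exact: mem_linear_span.
exact: linear_span_sub.
Qed.

Lemma linear_span_nil : linear_span [set` [::]] = [set (0 : E)].
Proof.
apply/seteqP; split; last first.
  by move=> _ ->; case: (linear_span_subspace [set` [::] : seq E]).
apply: linear_span_sub => //; split => // a _ _ -> ->.
by rewrite /= scaler0 addr0.
Qed.

Lemma linear_span_cons z s : linear_span [set` z :: s] =
  [set x | exists (a : R) v, linear_span [set` s] v /\ x = a *: z + v].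
Proof.
have [S0 SD] := linear_span_subspace [set` s].
apply/seteqP; split.
  apply: linear_span_sub.
    split; first by exists 0, 0; rewrite scale0r addr0.
    move=> a _ _ [b [v [Sv ->]]] [c [w [Sw ->]]].
    exists (a * b + c), (a *: v + w); split; first exact: SD.
    by rewrite scalerDr scalerDl scalerA addrACA.
  move=> x /=; rewrite inE => /orP[/eqP ->|xs].
    by exists 1, 0; rewrite scale1r addr0.
  by exists 0, x; rewrite scale0r add0r; split => //; exact: mem_linear_span.
move=> _ [a [v [Sv ->]]].
have [_ TD] := linear_span_subspace [set` z :: s].
apply: TD; first by apply: mem_linear_span; rewrite /= mem_head.
apply: linear_span_sub Sv; first exact: linear_span_subspace.
by move=> x /= xs; apply: mem_linear_span; rewrite /= inE xs orbT.
Qed.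

(** Induction on the spanning list: modulo the subspace inside the span of the
    tail, at most one further generator is needed, and it can be taken in the
    subspace. *)
Lemma subspace_finite_dimensional s W : is_subspace W ->
  W `<=` linear_span [set` s] -> finite_dimensional W.
Proof.
elim: s W => [|z s IH] W sW Ws.
  exists [::]; apply/seteqP; split => //.
  by apply: linear_span_sub.
pose W' := W `&` linear_span [set` s].
have sW' : is_subspace W'.
  have [S0 SD] := linear_span_subspace [set` s]; case: sW => W0 WD.
  by split => // a u v [Wu Su] [Wv Sv]; split; [exact: WD|exact: SD].
have [t W't] : finite_dimensional W' by apply: IH => // x [].
have [WS|/existsNP[w /not_implyP[Ww nSw]]] :=
    pselect (W `<=` linear_span [set` s]).
  exists t; rewrite -W't /W'; apply/seteqP; split => [x Wx|x []//].
  by split => //; exact: WS.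
exists (w :: t); apply/seteqP; split; last first.
  apply: linear_span_sub => // x /=; rewrite inE => /orP[/eqP -> //|xt].
  have : W' x by rewrite W't; exact: mem_linear_span.
  by case.
move=> u Wu; rewrite linear_span_cons -W't.
have := Ws _ Ww; rewrite linear_span_cons => -[a [v [Sv wE]]].
have := Ws _ Wu; rewrite linear_span_cons => -[b [v' [Sv' uE]]].
have [S0 SD] := linear_span_subspace [set` s]; case: sW => W0 WD.
have a0 : a != 0.
  by apply/eqP => a0; apply: nSw; rewrite wE a0 scale0r add0r.
exists (b / a), (u - (b / a) *: w); split; last by rewrite addrC subrK.
split; first by rewrite addrC -scaleNr; exact: WD.
have -> : u - (b / a) *: w = (- (b / a)) *: v + v'.
  rewrite uE wE scalerDr scalerA divfK// opprD addrACA subrr add0r.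
  by rewrite addrC scaleNr.
exact: SD.
Qed.

End FiniteSpan.
(** * Coordinates and the barycenter map *)

Fact dual_linear {R : realType} {E : normedModType R} (phi : Dual E) :
  linear (phi : E -> R^o).
Proof. by have /dualP[] := dual_funP phi. Qed.

HB.instance Definition _ {R : realType} {E : normedModType R} (phi : Dual E) :=
  GRing.isLinear.Build R E R^o *:%R (phi : E -> R^o) (dual_linear phi).

Lemma dual_sumE {R : realType} {E : normedModType R} I (r : seq I)
    (F : I -> Dual E) x : (\sum_(i <- r) F i) x = \sum_(i <- r) F i x.
Proof. by elim/big_rec2: _ => // i _ phi _ <-. Qed.

(** The map [w |-> \sum_i i.1 w *: i.2] is a bounded projection onto the span,
    built one generator at a time.  A new generator [z] contributes its
    component [z - P z] outside the range of the current projection [P], with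
    coordinate obtained from a norming functional [psi] of [z - P z], corrected
    to [psi - psi \o P] so that it vanishes on the old span. *)
Lemma finite_span_coordinates {R : realType} {E : normedModType R} (s : seq E) :
  exists c : seq (Dual E * E), forall w, linear_span [set` s] w ->
    \sum_(i <- c) i.1 w *: i.2 = w.
Proof.
elim: s => [|z s [c cP]].
  by exists [::] => w; rewrite linear_span_nil big_nil => ->.
pose P w := \sum_(i <- c) i.1 w *: i.2.
have PD (a : R) u v : P (a *: u + v) = a *: P u + P v.
  rewrite /P scaler_sumr -big_split/=; apply: eq_bigr => i _.
  by rewrite linearP scalerDl scalerA.
pose z' := z - P z.
have [z'0|z'0] := eqVneq z' 0.
  exists c => w; rewrite linear_span_cons => -[a [v [Sv ->]]].
  rewrite -/(P _) PD [P v]cP//; congr (_ *: _ + _).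
  by apply/eqP; rewrite eq_sym -subr_eq0; exact/eqP.
have [psi [_ psiz']] := norming_functional z'.
pose chi : Dual E := `|z'|^-1 *: (psi - \sum_(i <- c) psi i.2 *: i.1).
have chiE w : chi w = `|z'|^-1 * psi (w - P w).
  rewrite linearB/=; congr (_ * (_ - _)).
  rewrite dual_sumE linear_sum/=; apply: eq_bigr => i _.
  by rewrite linearZ; exact: mulrC.
exists ((chi, z') :: c) => w; rewrite linear_span_cons => -[a [v [Sv ->]]].
rewrite big_cons -/(P _) PD [_.1]/= [_.2]/=.
have -> : chi (a *: z + v) = a.
  rewrite chiE PD [P v]cP// opprD addrACA subrr addr0 -scalerBr -/z'.
  by rewrite linearZ /= psiz' mulrCA mulVf ?normr_eq0// mulr1.
by rewrite [P v]cP// addrA -scalerDr subrK.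
Qed.

Section Barycenter.
Context {R : realType} (X : completeNormedModType R).
Local Notation "X ^#" := (Lip0 X R^o) (at level 2).

Fact delta_free (x : X) : evaluation x \in @lipschitz_free _ X.
Proof. by apply/asboolP/subset_closure; apply: mem_linear_span; exists x. Qed.

Definition delta (x : X) : LipschitzFree X := MkLipschitzFree (delta_free x).

Lemma lip0_le_dist (f : X^#) x y : `|f x - f y| <= `|f| * `|x - y|.
Proof.
exact: (best_constantP (fun=> normr_ge0 _) (@lip0_boundE _ _ _)
  (@lip0_bound_neq0 _ _ _) f (x, y)).
Qed.

Lemma lip0_norm_le (f : X^#) k : 0 <= k ->
  (forall x y, `|f x - f y| <= k * `|x - y|) -> `|f| <= k.
Proof.
move=> k0 fk; apply: (best_constant_le (@lip0_boundE _ _ _)) => // -[x y] /=.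
Qed.

Lemma delta_lipschitz x y : `|delta x - delta y| <= `|x - y|.
Proof.
apply: dual_norm_le => // f; rewrite mulrC; exact: lip0_le_dist.
Qed.

Fact dual_lip0 (phi : Dual X) : (phi : X -> R^o) \in lip0 X R^o.
Proof.
apply/lip0P; split; last by rewrite linear0.
by exists `|phi| => // x y; rewrite -linearB; exact: dual_le_norm.
Qed.

Definition lip0_of_dual (phi : Dual X) : X^# := MkLip0 (dual_lip0 phi).

Let bary (m : Dual X^#) x := forall phi : Dual X, m (lip0_of_dual phi) = phi x.

Let bary_norm m x : bary m x -> `|x| <= `|m|.
Proof.
move=> mx; have [phi [phi1 phix]] := norming_functional x.
rewrite -phix -mx (le_trans (ler_norm _))//.
rewrite (le_trans (dual_le_norm _ _))// ler_piMr//.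
apply: lip0_norm_le => // u v; rewrite mul1r -linearB; exact: phi1.
Qed.

Let baryD (a : R) m n x y :
  bary m x -> bary n y -> bary (a *: m + n) (a *: x + y).
Proof. by move=> mx ny phi; rewrite linearP/= -mx -ny. Qed.

Let baryB m n x y : bary m x -> bary n y -> bary (m - n) (x - y).
Proof. by move=> mx ny phi; rewrite linearB/= -mx -ny. Qed.

Let bary_exists (mu : LipschitzFree X) : exists x, bary mu x.
Proof.
have spanP m : linear_span (range (@evaluation _ X)) m -> exists x, bary m x.
  move: m; apply: linear_span_sub.
    split; first by exists 0 => phi; rewrite linear0.
    by move=> a u v [x ux] [y vy]; exists (a *: x + y); exact: baryD.
  by move=> _ [x _ <-]; exists x.
have /asboolP/closure_normP mu_cl := free_valP mu.
have approx (n : nat) : exists mx : Dual X^# * X,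
    bary mx.1 mx.2 /\ `|free_val mu - mx.1| <= 2^-1 ^+ n.
  have [|m Sm mum] := mu_cl (2^-1 ^+ n); first by rewrite exprn_gt0.
  by have [x mx] := spanP _ Sm; exists (m, x); split => //; exact: ltW.
have [u uP] := choice approx.
have dist i j : `|(u i).2 - (u j).2| <= 2^-1 ^+ i + 2^-1 ^+ j.
  have [bi ui] := uP i; have [bj uj] := uP j.
  apply: (@le_trans _ _ `|(u i).1 - (u j).1|).
    by apply: bary_norm; exact: baryB.
  rewrite -(subrKA (free_val mu)) (le_trans (ler_normD _ _))//.
  by rewrite lerD// distrC.
have [|n|x [_ xP]] := @geometric_cvg _ X (fun n => (u n).2) 3; rewrite ?ler0n//.
  apply: le_trans (dist _ _) _; rewrite (halfpow_double n).
  by rewrite mulr_natl (mulrSr _ 2) (mulrSr _ 1).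
exists x => phi; apply/eqP; rewrite -subr_eq0 -normr_le0.
apply: (@le0_of_halfpow _ _ (`|lip0_of_dual phi| + `|phi| * 3)) => n.
have [bn un] := uP n.
rewrite -(subrKA ((u n).1 (lip0_of_dual phi))) (le_trans (ler_normD _ _))//.
rewrite mulrDl lerD//.
  rewrite (le_trans (dual_le_norm (free_val mu - (u n).1) _))//.
  by rewrite mulrC ler_wpM2l.
by rewrite bn -linearB (le_trans (dual_le_norm _ _))// -mulrA ler_wpM2l.
Qed.

(** Norming functionals of points of [X] are 1-Lipschitz functions, so a
    barycenter has norm at most that of its functional.  Finite combinations of
    evaluations have barycenters; this bound and the completeness of [X] extend
    them to the closure. *)
Lemma barycenter_exists : exists beta : {linear LipschitzFree X -> X},
  (forall mu, `|beta mu| <= `|mu|) /\ forall x, beta (delta x) = x.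
Proof.
have uniq (m : Dual X^#) x y : bary m x -> bary m y -> x = y.
  move=> mx my; apply/eqP; rewrite -subr_eq0 -normr_le0.
  by rewrite -(normr0 (Dual X^#)) -(subrr m); apply: bary_norm; exact: baryB.
have [b bP] := choice bary_exists.
have b_lin : linear b.
  by move=> a u v; apply: uniq (bP _) _; exact: (baryD a (bP u) (bP v)).
pose beta : {linear LipschitzFree X -> X} :=
  HB.pack b (GRing.isLinear.Build R _ _ *:%R b b_lin).
exists beta; split => [mu|x]; first exact: bary_norm.
exact: uniq (bP _) _.
Qed.

End Barycenter.
(** * Smoothing a nonexpansive map *)

Section Smoothing.
Context {R : realType} {X : normedModType R} {V : completeNormedModType R}.
Implicit Types (g : X -> V) (h x y : X) (s : seq X).

Definition nonexpansive g := forall x y, `|g x - g y| <= `|x - y|.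

Definition increment_lipschitz c h g :=
  forall x y, `|(g (x + h) - g x) - (g (y + h) - g y)| <= c * `|x - y|.

Definition midpoint_average h g x := 2^-1 *: (g x + g (x + h)).

Lemma norm_half_le (a b : V) r :
  `|a| <= r -> `|b| <= r -> `|2^-1 *: (a + b)| <= r.
Proof.
move=> ar br; rewrite normrZ gtr0_norm ?invr_gt0//.
rewrite ler_pdivrMl// mulr_natl mulr2n (le_trans (ler_normD _ _))//.
exact: lerD.
Qed.

Lemma nonexpansive_average h g :
  nonexpansive g -> nonexpansive (midpoint_average h g).
Proof.
move=> g1 x y; rewrite /midpoint_average -scalerBr opprD addrACA.
apply: norm_half_le => //; apply: le_trans (g1 _ _) _.
by rewrite opprD addrACA subrr addr0.
Qed.

Lemma increment_lipschitz_average c h h' g : increment_lipschitz c h g ->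
  increment_lipschitz c h (midpoint_average h' g).
Proof.
move=> gc x y; rewrite /midpoint_average -!scalerBr.
have -> : (g (x + h) + g (x + h + h') - (g x + g (x + h')) -
    (g (y + h) + g (y + h + h') - (g y + g (y + h')))) =
  ((g (x + h) - g x) - (g (y + h) - g y)) +
  ((g (x + h' + h) - g (x + h')) - (g (y + h' + h) - g (y + h'))).
  have subDD (a b a' b' : V) : (a + b) - (a' + b') = (a - a') + (b - b').
    by rewrite opprD addrACA.
  by rewrite (subDD (g (x + h))) (subDD (g (y + h))) subDD !(addrAC _ h h').
apply: norm_half_le => //; apply: le_trans (gc _ _) _.
by rewrite opprD addrACA subrr addr0.
Qed.

(** Averaging over the segment of length [h] turns the increment by [h] into
    half the increment by [h + h].  Averaging along [w/2], [w/4], [w/8], ... in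
    succession (which is averaging over the uniform distribution on the segment
    from [0] to [w], written in binary) therefore makes all increments by
    [2^-k w] Lipschitz with a constant proportional to [2^-k]: the average is
    differentiable along [w], with Lipschitz derivative. *)
Lemma increment_lipschitz_halve c h g : increment_lipschitz c (h + h) g ->
  increment_lipschitz (2^-1 * c) h (midpoint_average h g).
Proof.
move=> gc x y.
have E z : midpoint_average h g (z + h) - midpoint_average h g z =
    2^-1 *: (g (z + (h + h)) - g z).
  rewrite /midpoint_average -scalerBr opprD (addrC (- g z)) addrACA subrr add0r.
  by rewrite addrA.
rewrite !E -scalerBr normrZ gtr0_norm ?invr_gt0// -mulrA ler_wpM2l//.
Qed.

Lemma average_dist h g x : nonexpansive g ->
  `|midpoint_average h g x - g x| <= `|h|.
Proof.
move=> g1; have -> : midpoint_average h g x - g x =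
    2^-1 *: (0 + (g (x + h) - g x)).
  rewrite add0r -[X in _ - X](scalerK (V:=V) (a:=2)) ?pnatr_eq0// -scalerBr.
  by rewrite scaler_nat mulr2n opprD addrA [_ + g (x + h)]addrC addrK.
apply: norm_half_le; first by rewrite normr0.
by apply: le_trans (g1 _ _) _; rewrite addrC addKr.
Qed.

(** Every property used below is an affine condition on translates of [g],
    hence survives averaging; this is how the gain of one averaging is kept during all
    the later ones. *)
Lemma foldr_average_ind (P : (X -> V) -> Prop) :
  (forall h g, P g -> P (midpoint_average h g)) ->
  forall s g, P g -> P (foldr midpoint_average g s).
Proof. by move=> PQ s g Pg; elim: s => //= h s; exact: PQ. Qed.

Lemma foldr_average_dist s g x : nonexpansive g ->
  `|foldr midpoint_average g s x - g x| <= \sum_(h <- s) `|h|.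
Proof.
move=> g1; elim: s => [|h s IH]; first by rewrite subrr normr0 big_nil.
rewrite big_cons /= -(subrKA (foldr midpoint_average g s x)).
rewrite (le_trans (ler_normD _ _))// lerD// average_dist//.
exact: foldr_average_ind nonexpansive_average _ _ g1.
Qed.

Lemma foldr_average_halve c h s g : h \in s ->
  increment_lipschitz c (h + h) g ->
  increment_lipschitz (2^-1 * c) h (foldr midpoint_average g s).
Proof.
case/splitPr => s1 s2 gc; rewrite foldr_cat /=.
apply: (foldr_average_ind (P := increment_lipschitz (2^-1 * c) h)).
  exact: increment_lipschitz_average.
apply: increment_lipschitz_halve.
apply: (foldr_average_ind (P := increment_lipschitz c (h + h))) gc.
exact: increment_lipschitz_average.
Qed.

Lemma nonexpansive_increment h g : nonexpansive g -> increment_lipschitz 2 h g.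
Proof.
move=> g1 x y; rewrite opprB (addrC (g y)) addrACA mulr_natl mulr2n.
rewrite (le_trans (ler_normD _ _))// lerD//; last by rewrite addrC distrC g1.
by rewrite (le_trans (g1 _ _))// opprD addrACA subrr addr0.
Qed.

Section Stages.
Variables (w : nat -> X) (g0 : X -> V).
Hypothesis w_small : forall n, `|w n| <= 2^-1 ^+ n.+1.
Hypothesis g0_nonexpansive : nonexpansive g0.

(** Stage [k] averages along the [k]-th binary digit of each of the first [k]
    directions, so that every direction is eventually treated at all scales. *)
Fixpoint smooth_stage k : X -> V := if k is k'.+1 then
  foldr midpoint_average (smooth_stage k')
    [seq 2^-1 ^+ k *: w n | n <- iota 0 k] else g0.

Lemma smooth_stage_ind (P : (X -> V) -> Prop) :
  (forall h g, P g -> P (midpoint_average h g)) ->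
  forall m k, P (smooth_stage m) -> P (smooth_stage (m + k)).
Proof.
move=> PQ m k Pm; elim: k => [|k IH]; first by rewrite addn0.
by rewrite addnS; exact: foldr_average_ind.
Qed.

Lemma smooth_stage_nonexpansive k : nonexpansive (smooth_stage k).
Proof. exact: (smooth_stage_ind nonexpansive_average (m := 0)). Qed.

Lemma smooth_stage_dist k x :
  `|smooth_stage k x - smooth_stage k.+1 x| <= 1 * 2^-1 ^+ k.+1.
Proof.
rewrite distrC.
rewrite (le_trans (foldr_average_dist _ _ (smooth_stage_nonexpansive k)))//.
rewrite big_map mulrC.
under eq_bigr => n _ do rewrite normrZ ger0_norm ?exprn_ge0//.
rewrite -mulr_sumr ler_wpM2l ?exprn_ge0//.
rewrite -[iota 0 k.+1]/(index_iota 0 k.+1).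
suff : \sum_(0 <= n < k.+1) `|w n| <= 1 - 2^-1 ^+ k.+1.
  by move=> /le_trans; apply; rewrite gerBl exprn_ge0.
elim: k.+1 => [|m IH]; first by rewrite big_nil subrr.
rewrite big_nat_recr//= (le_trans (lerD IH (w_small m)))//.
by rewrite [in X in X <= _]halfpow_double opprD addrA subrK.
Qed.

(** Direction [n] enters at stage [n + 1], so the halving starts from the
    trivial constant [2] at scale [2^-n]; this is the factor [2 * 2 ^+ n]. *)
Lemma smooth_stage_increment n k :
  increment_lipschitz (2 * 2 ^+ n * 2^-1 ^+ k) (2^-1 ^+ k *: w n)
    (smooth_stage (maxn n k)).
Proof.
have [kn|nk] := leqP k n.
  move=> x y; have n1 := smooth_stage_nonexpansive n.
  apply: le_trans (nonexpansive_increment _ n1 x y) _.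
  rewrite ler_wpM2r// -mulrA ler_peMr// exprVn ler_pdivlMr ?exprn_gt0//.
  by rewrite mul1r ler_weXn2l// ler1n.
rewrite -(subnKC (ltnW nk)); elim: (k - n)%N => [|j IH].
  rewrite addn0 -mulrA exprVn divff ?expf_neq0 ?pnatr_eq0// mulr1.
  exact: nonexpansive_increment (smooth_stage_nonexpansive _).
rewrite addnS exprS mulrCA.
apply: (foldr_average_halve
  (s := [seq 2^-1 ^+ (n + j).+1 *: w i | i <- iota 0 (n + j).+1])).
  rewrite -exprS; apply/mapP; exists n => //.
  by rewrite mem_iota /= add0n ltnS leq_addr.
by rewrite -(exprS 2^-1) -scalerDl -halfpow_double.
Qed.

Lemma smoothing_exists : exists G : X -> V,
  [/\ forall x, (fun k => smooth_stage k x) @ \oo --> G x,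
      nonexpansive G &
      forall n k, increment_lipschitz (2 * 2 ^+ n * 2^-1 ^+ k)
        (2^-1 ^+ k *: w n) G].
Proof.
have lim x : exists l : V, (fun k => smooth_stage k x) @ \oo --> l.
  have [l [ul _]] := geometric_cvg ler01 (smooth_stage_dist^~ x).
  by exists l.
have [G GP] := choice lim; exists G; split => // [x y|n k x y].
  have c : (fun k => smooth_stage k x - smooth_stage k y) @ \oo --> G x - G y.
    by apply: cvgB; exact: GP.
  apply: (cvg_norm_le (N := 0) c) => k _; exact: smooth_stage_nonexpansive.
set h := _ *: w n.
have c : (fun m => (smooth_stage m (x + h) - smooth_stage m x) -
    (smooth_stage m (y + h) - smooth_stage m y)) @ \oo -->
    (G (x + h) - G x) - (G (y + h) - G y).
  by apply: cvgB; apply: cvgB; exact: GP.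
apply: (cvg_norm_le (N := maxn n k) c) => m nkm.
rewrite -(subnKC nkm); apply: (smooth_stage_ind (P := increment_lipschitz _ h)).
  exact: increment_lipschitz_average.
exact: smooth_stage_increment.
Qed.

End Stages.

End Smoothing.
(** * Differentiability at the origin *)

Section StrongDerivative.
Context {R : realType} {X : normedModType R} {V : completeNormedModType R}.
Variable G : X -> V.
Hypothesis G_nonexpansive : nonexpansive G.

(** Directional differentiability at [0] with an error that is also controlled
    at nearby base points: unlike for the mere existence of directional
    derivatives, such derivatives add up. *)
Definition derivative_at0 (v : X) (mu : V) := exists2 C : R, 0 <= C &
  forall t x, `|G (x + t *: v) - G x - t *: mu| <= C * `|t| * (`|x| + `|t|).

Lemma derivative_at0_0 : derivative_at0 0 0.
Proof.
by exists 0 => // t x; rewrite !scaler0 addr0 !subrr normr0 !mul0r.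
Qed.

Lemma derivative_at0D u v mu nu : derivative_at0 u mu -> derivative_at0 v nu ->
  derivative_at0 (u + v) (mu + nu).
Proof.
move=> [C C0 uC] [D D0 vD]; exists (C * (`|v| + 1) + D) => [|t x].
  by rewrite addr_ge0// mulr_ge0// addr_ge0.
have -> : G (x + t *: (u + v)) - G x - t *: (mu + nu) =
    (G ((x + t *: v) + t *: u) - G (x + t *: v) - t *: mu) +
    (G (x + t *: v) - G x - t *: nu).
  rewrite [RHS]addrACA subrKA -opprD scalerDr.
  by rewrite [in LHS]scalerDr (addrC (t *: u)) addrA.
rewrite (le_trans (ler_normD _ _))// [(_ + D) * _]mulrDl [leRHS]mulrDl lerD//.
rewrite (le_trans (uC _ _))// [C * (_ + 1) * _]mulrAC -[leRHS]mulrA.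
rewrite ler_wpM2l ?mulr_ge0// mulrDl mul1r mulrDr addrA lerD2r.
rewrite (le_trans (ler_normD _ _))// normrZ [leRHS]addrC lerD2l (mulrC `|t|).
by rewrite lerDr mulr_ge0.
Qed.

Lemma derivative_at0Z a v mu : derivative_at0 v mu ->
  derivative_at0 (a *: v) (a *: mu).
Proof.
move=> [C C0 vC]; exists (C * `|a| * (1 + `|a|)) => [|t x].
  by rewrite !mulr_ge0// addr_ge0.
rewrite !scalerA (le_trans (vC _ _))// normrM (mulrC `|t|) mulrA.
rewrite [C * _ * (1 + _) * _]mulrAC -[leRHS]mulrA ler_wpM2l ?mulr_ge0//.
by rewrite mulrDl mul1r mulrDr addrACA lerD// ?lerDl ?lerDr ?mulr_ge0.
Qed.

Lemma derivative_at0_le v mu : derivative_at0 v mu -> `|mu| <= `|v|.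
Proof.
move=> [C C0 vC]; rewrite -subr_le0; apply: (@le0_of_halfpow _ _ C) => n.
have h0 : 0 < 2^-1 ^+ n :> R by rewrite exprn_gt0.
have := vC (2^-1 ^+ n) 0.
rewrite normr0 (gtr0_norm h0) (add0r (2^-1 ^+ n)) => vCn.
rewrite -(ler_pM2l h0) mulrBr lerBlDr [_ * (C * _)]mulrCA mulrA.
rewrite -{1}(gtr0_norm h0) -normrZ.
rewrite -[_ *: mu](subKr (G (0 + 2^-1 ^+ n *: v) - G 0)).
rewrite (le_trans (ler_normB _ _))// [leLHS]addrC lerD//.
by rewrite (le_trans (G_nonexpansive _ _))// subr0 add0r normrZ gtr0_norm.
Qed.

Lemma derivative_at0_section (beta : {linear V -> X}) v mu :
  (forall nu, `|beta nu| <= `|nu|) ->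
  (forall x, beta (G x) = beta (G 0) + x) ->
  derivative_at0 v mu -> beta mu = v.
Proof.
move=> beta1 betaG [C C0 vC]; apply/eqP; rewrite eq_sym -subr_eq0 -normr_le0.
apply: (@le0_of_halfpow _ _ C) => n.
have h0 : 0 < 2^-1 ^+ n :> R by rewrite exprn_gt0.
have := vC (2^-1 ^+ n) 0; rewrite normr0 !add0r (gtr0_norm h0) => vCn.
rewrite -(ler_pM2l h0) mulrCA mulrA -{1}(gtr0_norm h0) -normrZ.
apply: le_trans vCn; apply: le_trans (beta1 _).
rewrite (linearB beta) (linearB beta) linearZ/= betaG [beta _ + _]addrC addrK.
by rewrite scalerBr.
Qed.

(** Along dyadic steps the difference quotients form a Cauchy sequence because
    the increments depend on the base point in a Lipschitz way; the limit
    controls integer multiples of dyadic steps by summation, and all real steps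
    by density. *)
Lemma derivative_at0_exists w (c : R) : 0 <= c ->
  (forall k, increment_lipschitz (c * 2^-1 ^+ k) (2^-1 ^+ k *: w) G) ->
  exists mu, derivative_at0 w mu.
Proof.
move=> c0 Gc; pose h k := 2^-1 ^+ k : R.
have h0 k : 0 < h k by rewrite exprn_gt0.
pose D k : V := (h k)^-1 *: (G (h k *: w) - G 0).
have DE k : G (h k *: w) - G 0 = h k *: D k by rewrite scalerKV// gt_eqF.
(* Halving the step changes the difference quotient by half the difference of
   two increments based at nearby points. *)
have [||mu [_ muP]] := @geometric_cvg _ V D (c * `|w|).
  by rewrite mulr_ge0.
  move=> k.
  have -> : D k - D k.+1 = (h k)^-1 *: ((G (h k.+1 *: w + h k.+1 *: w) -
      G (h k.+1 *: w)) - (G (0 + h k.+1 *: w) - G 0)).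
    apply: (scalerI (lt0r_neq0 (h0 k))).
    rewrite [RHS]scalerKV ?gt_eqF// scalerBr -DE (halfpow_double k : h k = _).
    by rewrite !scalerDl -!DE add0r opprD addrA opprB subrKA.
  rewrite normrZ gtr0_norm ?invr_gt0// ler_pdivrMl// (le_trans (Gc _ _ _))//.
  rewrite subr0 normrZ gtr0_norm// -/(h _) [leRHS]mulrC [c * _ * h _]mulrAC.
  rewrite -[leRHS]mulrA; apply: ler_wpM2l.
    by rewrite mulr_ge0 ?(ltW (h0 _)).
  rewrite [leLHS]mulrC; apply: ler_wpM2l => //.
  by rewrite [leRHS](halfpow_double k : h k = _) lerDl ltW.
have step k x : `|G (x + h k *: w) - G x - h k *: mu|
    <= c * h k * (`|x| + h k * `|w|).
  rewrite -(subrKA (G (0 + h k *: w) - G 0)) (le_trans (ler_normD _ _))//.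
  rewrite mulrDr lerD//; first by rewrite (le_trans (Gc _ _ _))// subr0.
  rewrite add0r DE -scalerBr normrZ gtr0_norm// (mulrC c) -mulrA.
  apply: ler_wpM2l; first exact: ltW.
  by rewrite (le_trans (muP k))// -mulrA (mulrC `|w|).
have steps k x m : `|G (x + (m%:R * h k) *: w) - G x - (m%:R * h k) *: mu|
    <= c * (m%:R * h k) * (`|x| + m%:R * h k * `|w|).
  elim: m => [|m IH].
    by rewrite !mul0r !scale0r addr0 !subrr normr0 mulr0 mul0r.
  rewrite -natr1 !(mulrDl _ 1) mul1r !scalerDl addrA.
  set y := x + _.
  have -> : G (y + h k *: w) - G x - ((m%:R * h k) *: mu + h k *: mu) =
      (G (y + h k *: w) - G y - h k *: mu) + (G y - G x - (m%:R * h k) *: mu).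
    by rewrite [RHS]addrACA subrKA -opprD [_ *: mu + _]addrC.
  rewrite (le_trans (ler_normD _ _))// [leLHS]addrC mulrDr mulrDl; apply: lerD.
    apply: (le_trans IH); apply: ler_wpM2l; first by rewrite !mulr_ge0// ltW.
    by rewrite lerD2l ler_wpM2r// lerDl ltW.
  apply: (le_trans (step _ _)); apply: ler_wpM2l.
    by rewrite mulr_ge0// ltW.
  rewrite mulrDl addrA lerD2r (le_trans (ler_normD _ _))// lerD2l normrZ.
  rewrite ger0_norm//.
  by rewrite mulr_ge0// ltW.
have pos t x : 0 <= t ->
    `|G (x + t *: w) - G x - t *: mu| <= c * t * (`|x| + t * `|w|).
  (* Real steps are approximated by integer multiples of dyadic ones, since G
     is continuous. *)
  move=> t0; rewrite -subr_le0.
  apply: (@le0_of_halfpow _ _ (`|w| + `|mu|)) => k.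
  have [m mt tm] : exists2 m, m%:R * h k <= t & t - m%:R * h k <= h k.
    exists (Num.truncn (t / h k)).
      by rewrite -ler_pdivlMr// truncn_le divr_ge0// ltW.
    rewrite lerBlDl -[X in _ + X]mul1r -mulrDl; apply: ltW.
    rewrite -ltr_pdivrMr// natr1.
    exact: truncnS_gt.
  set T := m%:R * h k in mt tm *.
  have T0 : 0 <= T by rewrite mulr_ge0// ltW.
  have -> : G (x + t *: w) - G x - t *: mu =
      (G (x + t *: w) - G (x + T *: w) - (t - T) *: mu) +
      (G (x + T *: w) - G x - T *: mu).
    by rewrite [RHS]addrACA subrKA -opprD -scalerDl subrK.
  rewrite lerBlDr (le_trans (ler_normD _ _))// lerD//; last first.
    apply: (le_trans (steps k x m)); rewrite -/T.
    apply: ler_pM; [exact: mulr_ge0| |exact: ler_wpM2l|].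
      by rewrite addr_ge0// mulr_ge0.
    by rewrite lerD2l ler_wpM2r.
  rewrite mulrDl (le_trans (ler_normB _ _))// lerD//; last first.
    by rewrite normrZ ger0_norm ?subr_ge0// mulrC ler_wpM2l.
  apply: le_trans (G_nonexpansive _ _) _.
  rewrite opprD addrACA subrr add0r -scalerBl.
  by rewrite normrZ ger0_norm ?subr_ge0// mulrC ler_wpM2l.
exists mu, (c * (1 + 2 * `|w|)) => [|t x].
  by rewrite mulr_ge0// addr_ge0// mulr_ge0.
have fin (a : R) : a <= `|x| + 2 * `|t| * `|w| ->
    c * `|t| * a <= c * (1 + 2 * `|w|) * `|t| * (`|x| + `|t|).
  move=> ax; rewrite [c * (1 + _) * _]mulrAC -[leRHS]mulrA.
  apply: ler_wpM2l; first exact: mulr_ge0.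
  apply: (le_trans ax); rewrite [leRHS]mulrDl mul1r mulrDr [leRHS]addrACA.
  apply: lerD; first by rewrite lerDl !mulr_ge0.
  by rewrite mulrAC lerDr.
have [t0|t0] := leP 0 t.
  apply: (le_trans (pos t x t0)); rewrite -{1}(ger0_norm t0); apply: fin.
  by rewrite lerD2l ler_wpM2r// ger0_norm// ler_peMl// ler1n.
rewrite distrC.
have -> : t *: mu - (G (x + t *: w) - G x) =
    G ((x + t *: w) + - t *: w) - G (x + t *: w) - (- t) *: mu.
  by rewrite !scaleNr addrK opprK opprB addrC.
have t0' : 0 <= - t by rewrite oppr_ge0 ltW.
have tN : - t = `|t| by rewrite ltr0_norm.
apply: (le_trans (pos (- t) (x + t *: w) t0')); rewrite tN; apply: fin.
rewrite (le_trans (lerD (ler_normD _ _) (lexx _)))// normrZ -addrA lerD2l.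
by rewrite -mulrA mulr_natl mulr2n.
Qed.

End StrongDerivative.
(** * Linear isometric sections and transfer of the approximation property *)

Lemma closure_subspace {R : realType} {V : normedModType R} (A : set V) :
  is_subspace A -> is_subspace (closure A).
Proof.
move=> [A0 AD]; split; first exact: subset_closure.
move=> a u v /closure_normP clu /closure_normP clv; apply/closure_normP => e e0.
have e1 : 0 < e / 2 / (`|a| + 1) by rewrite !divr_gt0// ltr_wpDl.
have [u' Au uu'] := clu _ e1.
have [v' Av vv'] := clv (e / 2) (divr_gt0 e0 (ltr0n _ 2)).
exists (a *: u' + v'); first exact: AD.
rewrite opprD addrACA -scalerBr (le_lt_trans (ler_normD _ _))//.
rewrite (splitr e) ler_ltD// normrZ.
rewrite ltr_pdivlMr ?ltr_wpDl// in uu'; apply: le_trans (ltW uu').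
by rewrite mulrC ler_wpM2l// lerDl.
Qed.

Section LinearSection.
Context {R : realType} {X V : completeNormedModType R}.
Variables (beta : {linear V -> X}) (g0 : X -> V).
Hypothesis beta_contraction : forall mu, `|beta mu| <= `|mu|.
Hypothesis g0_nonexpansive : nonexpansive g0.
Hypothesis g0K : forall x, beta (g0 x) = x.

(** A linear contraction with a nonexpansive, possibly nonlinear, section has
    linear isometric sections over separable subspaces (Godefroy and Kalton);
    [M] is the range of such a section.  Averaging preserves the identity
    [beta (g x) = beta (g 0) + x], so the smoothed section [G] satisfies it, and
    differentiating it shows that the derivatives of [G] at [0] are mapped by
    [beta] to the directions of differentiation.  They form a subspace, have
    norm at most that of the direction, and exist along small multiples of all
    the [e n]. *)
Lemma separable_linear_section (e : nat -> X) : exists M : set V,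
  [/\ is_subspace M, closed M, forall mu, M mu -> `|mu| <= `|beta mu| &
      forall n, exists2 mu, M mu & beta mu = e n].
Proof.
pose r n : R := 2^-1 ^+ n.+1 / (1 + `|e n|).
have e1 n : 0 < 1 + `|e n| by rewrite ltr_pwDl.
have r0 n : 0 < r n by rewrite divr_gt0// exprn_gt0.
pose w n := r n *: e n.
have w_small n : `|w n| <= 2^-1 ^+ n.+1.
  rewrite normrZ gtr0_norm// mulrAC ler_pdivrMr// ler_wpM2l ?exprn_ge0//.
  by rewrite lerDr.
have [G [G_lim G1 Gw]] := smoothing_exists w_small g0_nonexpansive.
have stageK k x :
    beta (smooth_stage w g0 k x) = beta (smooth_stage w g0 k 0) + x.
  move: x; have stage_ind := @smooth_stage_ind _ _ _ w g0
    (fun g => forall x, beta (g x) = beta (g 0) + x).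
  apply: (stage_ind _ 0 k) => [h g gK x|x]; last by rewrite !g0K add0r.
  rewrite /midpoint_average !linearZ/= !linearD/= [beta (g x)]gK.
  rewrite [beta (g (x + h))]gK [beta (g (0 + h))]gK add0r.
  have half : x = 2^-1 *: (x + x).
    by rewrite -mulr2n -(scaler_nat 2 x) scalerK ?pnatr_eq0.
  rewrite -!scalerDr; have -> z : 2^-1 *: z + x = 2^-1 *: (z + (x + x)).
    by rewrite scalerDr -half.
  by congr (_ *: _); rewrite addrACA (addrA x x h) (addrC _ h) !addrA.
have GK x : beta (G x) = beta (G 0) + x.
  apply/eqP; rewrite -subr_eq0 -normr_le0; apply/ler_addgt0Pl => d d0.
  have c : (fun k => smooth_stage w g0 k x - smooth_stage w g0 k 0) @ \oo -->
      G x - G 0 by apply: cvgB; exact: G_lim.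
  move/cvgrPdist_lt : c => /(_ d d0)[k _ /(_ k (leqnn k))/=] /ltW.
  rewrite addr0; apply: le_trans; apply: le_trans (beta_contraction _).
  rewrite !(linearB beta) stageK (addrC (beta (smooth_stage _ _ _ 0))) addrK.
  by rewrite opprD addrA.
pose M := [set mu | exists v, derivative_at0 G v mu].
have sM : is_subspace M.
  split; first by exists 0; exact: derivative_at0_0.
  move=> a mu nu [u umu] [v vnu]; exists (a *: u + v).
  by apply: derivative_at0D => //; exact: derivative_at0Z.
have Miso mu : M mu -> `|mu| <= `|beta mu|.
  move=> [v vmu]; rewrite (derivative_at0_section beta_contraction GK vmu).
  exact: (derivative_at0_le G1 vmu).
exists (closure M); split.
- exact: closure_subspace.
- exact: closed_closure.
- move=> mu /closure_normP clmu; apply/ler_addgt0Pl => d d0.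
  have [nu Mnu munu] := clmu (d / 2) (divr_gt0 d0 (ltr0n _ 2)).
  apply: (@le_trans _ _ (`|mu - nu| + `|nu|)).
    by rewrite -{1}[mu](subrK nu) ler_normD.
  rewrite (splitr d) -addrA; apply: lerD; first exact: ltW.
  apply: le_trans (Miso _ Mnu) _.
  rewrite -[beta nu](subKr (beta mu)) -(linearB beta).
  rewrite (le_trans (ler_normB _ _))// [leLHS]addrC lerD2r.
  by rewrite (le_trans (beta_contraction _))// ltW.
- move=> n.
  have [||mu mun] := @derivative_at0_exists _ _ _ _ G1 (w n) (2 * 2 ^+ n).
    by rewrite mulr_ge0// exprn_ge0.
    exact: Gw.
  exists ((r n)^-1 *: mu).
    apply: subset_closure; exists ((r n)^-1 *: w n); exact: derivative_at0Z.
  rewrite linearZ/= (derivative_at0_section beta_contraction GK mun).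
  by rewrite scalerK// gt_eqF.
Qed.

(** The lifted set is the preimage of [K] in a subspace [M] on which [beta] is
    isometric.  It inherits closedness from [K], and lifting the generating
    sequence of [K] to [M] does not increase norms; isometry turns convergence
    in [X] into convergence in [M]. *)
Lemma p_compact_lift p (K : set X) : 0 <= p -> p_compact p K ->
  exists M : set V, exists K' : set V,
  [/\ is_subspace M, forall mu, M mu -> `|mu| <= `|beta mu|, K' `<=` M,
      p_compact p K' & K = beta @` K'].
Proof.
move=> p0 [Kcl [e e_sum Ke]].
have [M [sM Mcl Miso Me]] := separable_linear_section e.
have [M0 MD] := sM.
have MB mu nu : M mu -> M nu -> M (mu - nu).
  by move=> Mmu Mnu; rewrite addrC -scaleN1r; exact: MD.
have Me' n : exists mu, M mu /\ beta mu = e n.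
  by have [mu Mmu mun] := Me n; exists mu.
have [u uP] := choice Me'.
have Mseries (a : nat -> R) n : M (series (fun k => a k *: u k) n).
  rewrite /series/=; elim: n => [|n IH]; first by rewrite big_geq.
  by rewrite big_nat_recr//= addrC; apply: MD => //; case: (uP n).
have betaseries (a : nat -> R) n :
    beta (series (fun k => a k *: u k) n) = series (fun k => a k *: e k) n.
  rewrite /series/= linear_sum; apply: eq_bigr => k _.
  by rewrite linearZ/=; case: (uP k) => _ ->.
exists M, [set mu | M mu /\ K (beta mu)]; split => //.
- by move=> mu [].
- split.
    apply/closure_id/seteqP; split; first exact: subset_closure.
    move=> mu /closure_normP clmu; split.
      rewrite (closure_id M).1//; apply/closure_normP => d d0.
      by have [nu [Mnu _] munu] := clmu d d0; exists nu.
    rewrite (closure_id K).1//; apply/closure_normP => d d0.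
    have [nu [_ Knu] munu] := clmu d d0; exists (beta nu) => //.
    by rewrite -linearB (le_lt_trans (beta_contraction _)).
  exists u.
    apply: le_lt_trans e_sum; apply: lee_nneseries => [n _ _|n _].
      by rewrite lee_fin powR_ge0.
    have [Mu ue] := uP n; rewrite lee_fin.
    apply: ge0_ler_powR; rewrite ?nnegrE// -ue.
    exact: Miso.
  move=> mu [Mmu /Ke[a pa c]]; exists a => //.
  apply/cvgrPdist_lt => d d0; move/cvgrPdist_lt : c => /(_ d d0).
  apply: filterS => n; apply: le_lt_trans.
  by rewrite -betaseries -linearB; apply: Miso; exact: MB.
- apply/seteqP; split; last by move=> _ [mu [_ Kmu] <-].
  move=> x Kx; have [a pa c] := Ke _ Kx.
  have [nu nuP] : exists nu : V, series (fun k => a k *: u k) @ \oo --> nu.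
    apply: cauchy_seq_cvg => d d0.
    have d2 : 0 < d / 2 by rewrite divr_gt0.
    move/cvgrPdist_lt : c => /(_ _ d2)[N _ cN].
    exists N => n Nn.
    apply: le_lt_trans (Miso _ (MB _ _ (Mseries _ _) (Mseries _ _))) _.
    rewrite linearB/= !betaseries -(subrKA x) (le_lt_trans (ler_normD _ _))//.
    rewrite (splitr d); apply: ltrD; last exact: (cN n Nn).
    by rewrite distrC; exact: (cN N (leqnn N)).
  have Mnu : M nu.
    rewrite (closure_id M).1//; apply: (closed_cvg (closure M) _ _ _ nuP).
      exact: closed_closure.
    by apply: nearW => n; apply: subset_closure; exact: Mseries.
  have nux : beta nu = x.
    apply/eqP; rewrite -subr_eq0 -normr_le0; apply/ler_addgt0Pl => d d0.
    rewrite addr0 (splitr d).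
    have d2 : 0 < d / 2 by rewrite divr_gt0.
    move/cvgrPdist_lt : c => /(_ _ d2) c.
    move/cvgrPdist_lt : nuP => /(_ _ d2) nuP.
    near \oo => n.
    rewrite -(subrKA (series (fun k => a k *: e k) n)).
    rewrite (le_trans (ler_normD _ _))//.
    rewrite lerD//; last by rewrite distrC ltW//; near: n.
    rewrite -betaseries -linearB (le_trans (beta_contraction _))// ltW//.
    by near: n.
  by exists nu => //; split => //; rewrite nux.
Unshelve. all: by end_near. Qed.

(** Given a finite-rank operator [T] that is close to the identity on the lifted
    compact set, [beta \o T] composed with the linear section is a finite-rank
    operator on the separable subspace [beta @` M] of [X].  Its coordinates
    extend to all of [X] by the Hahn-Banach theorem. *)
Lemma p_approximation_property_contraction p : 0 <= p ->
  p_approximation_property p V -> p_approximation_property p X.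
Proof.
move=> p0 VAP K eps Kp eps0.
have [M [K' [sM Miso K'M K'p ->]]] := p_compact_lift p0 Kp.
have [T [[B TB] [s Ts] TK']] := VAP K' eps K'p eps0.
have [c cP] := finite_span_coordinates s.
have [M0 MD] := sM.
have extend (i : Dual V * V) : exists phi : Dual X,
    forall mu, M mu -> phi (beta mu) = i.1 (T mu).
  pose A : set (X * R^o) :=
    [set z | exists2 mu, M mu & z = (beta mu, i.1 (T mu))].
  have [|||phi [_ phiA]] := @hahn_banach R X (`|i.1| * `|B|) _ A.
  - by rewrite mulr_ge0.
  - split; first by exists 0 => //; rewrite !linear0.
    move=> a _ _ [mu Mmu ->] [nu Mnu ->].
    exists (a *: mu + nu); first exact: MD.
    by rewrite !linearP.
  - move=> _ _ [mu Mmu [-> ->]]; rewrite (le_trans (ler_norm _))//.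
    rewrite (le_trans (dual_le_norm _ _))// -mulrA ler_wpM2l//.
    rewrite (le_trans (TB _))//; apply: (@le_trans _ _ (`|B| * `|mu|)).
      by rewrite ler_wpM2r// ler_norm.
    by rewrite ler_wpM2l// Miso.
  by exists phi => mu Mmu; apply: phiA; exists mu.
have [Phi PhiP] := choice extend.
pose L x := \sum_(i <- c) Phi i x *: beta i.2.
have L_lin : linear L.
  move=> a x y; rewrite /L scaler_sumr -big_split/=; apply: eq_bigr => i _.
  by rewrite linearP scalerDl scalerA.
have LK mu : M mu -> L (beta mu) = beta (T mu).
  move=> Mmu; rewrite -[T mu]cP; last by rewrite -Ts; exists mu.
  rewrite linear_sum; apply: eq_bigr => i _.
  by rewrite linearZ/= PhiP.
pose Llin : {linear X -> X} :=
  HB.pack L (GRing.isLinear.Build R _ _ *:%R L L_lin).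
exists Llin; split.
- exists (\sum_(i <- c) `|Phi i| * `|beta i.2|) => x /=.
  rewrite (le_trans (ler_norm_sum _ _ _))// mulr_suml ler_sum// => i _.
  by rewrite normrZ mulrAC ler_wpM2r// dual_le_norm.
- apply: (@subspace_finite_dimensional _ _ [seq beta i.2 | i <- c]).
    split.
      by exists 0 => //; rewrite /= /L big1// => i _; rewrite linear0 scale0r.
    move=> a _ _ [x _ <-] [y _ <-].
    by exists (a *: x + y) => //=; rewrite L_lin.
  move=> _ [x _ <-] /=.
  have [S0 SD] := linear_span_subspace [set` [seq beta i.2 | i <- c]].
  rewrite /L big_seq; apply: (big_ind (linear_span _)) => //.
    by move=> u v Su Sv; rewrite -[u]scale1r; exact: SD.
  move=> i ic; rewrite -[_ *: _]addr0; apply: SD => //.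
  by apply: mem_linear_span => /=; apply/mapP; exists i.
- move=> _ [mu K'mu <-] /=; rewrite LK; last exact: K'M.
  by rewrite -linearB (le_lt_trans (beta_contraction _))// TK'.
Qed.

End LinearSection.
(** * Unions of p-compact sets *)

Section Interleaving.

Definition interleave {T} (x0 : T) (b : bool) (a : nat -> T) n :=
  if odd n == b then a n./2 else x0.

(** The number of indices of parity [b] below [n]. *)
Definition interleave_count (b : bool) n := if b then n./2 else uphalf n.

Lemma big_interleave {T} (x0 : T) (op : Monoid.law x0) b (a : nat -> T) n :
  \big[op/x0]_(0 <= k < n) interleave x0 b a k =
  \big[op/x0]_(0 <= k < interleave_count b n) a k.
Proof.
elim: n => [|n IH]; first by case: b; rewrite !big_geq.
rewrite big_nat_recr//= IH /interleave; case: b {IH} => /=; rewrite uphalf_half.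
  case: (odd n); last by rewrite Monoid.mulm1.
  by rewrite add1n big_nat_recr.
case: (odd n) => /=; first by rewrite Monoid.mulm1 add1n.
by rewrite add0n big_nat_recr.
Qed.

End Interleaving.

Section PCompactUnion.
Context {R : realType}.

Lemma counting_aeP (P : nat -> Prop) :
  (\forall n \ae (@counting nat R), P n) <-> forall n, P n.
Proof.
split=> [aeP n|PT]; last by apply: nearW.
apply: contrapT => nPn.
have /measure_negligible : (@counting nat R).-negligible [set n].
  by apply: negligibleS aeP => _ ->.
move=> /(_ I); rewrite /= /counting asboolT// fset_set1 finmap.cardfs1 => /eqP.
by rewrite onee_eq0.
Qed.

Lemma nneseries_interleave_le b (F : nat -> \bar R) : (forall n, 0 <= F n)%E ->
  (\sum_(0 <= n <oo) interleave 0 b F n <= \sum_(0 <= n <oo) F n)%E.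
Proof.
move=> F0; apply: lime_le.
  by apply: is_cvg_nneseries => n _ _; rewrite /interleave; case: ifP.
apply: nearW => n; rewrite big_interleave; exact: nneseries_lim_ge.
Qed.

Lemma lp'_ball_interleave (p : R) b a : 1 <= p ->
  lp'_ball p a -> lp'_ball p (interleave 0 b a).
Proof.
rewrite le_eqVlt => /orP[/eqP <-|p1]; rewrite /lp'_ball /=.
  rewrite hoelder_conjugate1 unlock; case: ifPn => // _.
  move=> /ess_supP/counting_aeP a1; apply/ess_supP/counting_aeP => n /=.
  rewrite /interleave; case: ifP => _; first exact: a1.
  by rewrite normr0 lee_fin ler01.
have p0 : 0 < p by exact: lt_trans p1.
have q0 : 0 < p / (p - 1) by rewrite divr_gt0// subr_gt0.
have -> : hoelder_conjugate p%:E = (p / (p - 1))%:E.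
  by rewrite /hoelder_conjugate/= eqe gt_eqF//= -EFinB inver subr_eq0 gt_eqF.
rewrite !Lnorm_counting//; apply: le_trans; apply: gt0_ler_poweR.
- by rewrite invr_ge0 ltW.
- by rewrite in_itv/= leey andbT nneseries_ge0// => n _ _; exact: poweR_ge0.
- by rewrite in_itv/= leey andbT nneseries_ge0// => n _ _; exact: poweR_ge0.
pose F k := (`|(a k)%:E| `^ (p / (p - 1)))%E.
rewrite (eq_eseriesr (g := interleave 0%E b F)); last first.
  move=> k _; rewrite /interleave /F /=; case: ifP => // _.
  by rewrite normr0 powR0// gt_eqF.
by apply: nneseries_interleave_le => k; exact: poweR_ge0.
Qed.

Context {E : normedModType R}.

Lemma p_compact0 (p : R) : 0 < p -> p_compact p (@set0 E).
Proof.
move=> p0; split; first exact: closed0.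
exists (fun=> 0) => //; rewrite eseries0// => n _ _.
by rewrite normr0 powR0// gt_eqF.
Qed.

(** The two generating sequences are interleaved, and the coefficients of a
    point of one set are extended by [0]. *)
Lemma p_compactU (p : R) (K L : set E) : 1 <= p ->
  p_compact p K -> p_compact p L -> p_compact p (K `|` L).
Proof.
move=> p1 [Kcl [e0 e0_sum Ke]] [Lcl [e1 e1_sum Le]].
split; first exact: closedU.
pose e b := if b then e1 else e0.
pose e' n := e (odd n) n./2.
exists e'.
  pose F b n := (`|e b n| `^ p)%:E.
  have F0 b n : (0 <= F b n)%E by rewrite lee_fin powR_ge0.
  have F'0 b n : (0 <= interleave 0 b (F b) n)%E.
    by rewrite /interleave; case: ifP.
  rewrite (eq_eseriesr (g := fun n =>
      (interleave 0 false (F false) n + interleave 0 true (F true) n)%E)).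
    rewrite nneseriesD//; apply: lte_add_pinfty.
      exact: le_lt_trans (nneseries_interleave_le _ (F0 _)) _.
    exact: le_lt_trans (nneseries_interleave_le _ (F0 _)) _.
  move=> n _; rewrite /interleave /e' /F.
  by case: (odd n) => /=; rewrite ?adde0 ?add0e.
have sub b a (x : E) : lp'_ball p a ->
    series (fun n => a n *: e b n) @ \oo --> x ->
    exists2 a', lp'_ball p a' & series (fun n => a' n *: e' n) @ \oo --> x.
  move=> pa c; exists (interleave 0 b a); first exact: lp'_ball_interleave.
  have -> : series (fun n => interleave 0 b a n *: e' n) =
      fun n => series (fun n => a n *: e b n) (interleave_count b n).
    apply/funext => n; rewrite /series/= -(big_interleave +%R).
    apply: eq_bigr => k _; rewrite /interleave /e'.
    by case: eqP => [->//|_]; rewrite scale0r.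
  apply/cvgrPdist_lt => d d0; move/cvgrPdist_lt : c => /(_ d d0)[N _ cN].
  exists N.*2 => // n /= Nn; apply: cN => /=.
  have : (N <= n./2)%N by rewrite -(doubleK N) half_leq.
  move=> /leq_trans; apply; rewrite /interleave_count; case: b => //.
  by rewrite uphalf_half leq_addl.
move=> x [/Ke[a pa c]|/Le[a pa c]]; first exact: (sub false a).
exact: (sub true a).
Qed.

End PCompactUnion.

(** * Lipschitz approximation *)

Section LipschitzApproximation.
Context {R : realType} (p : R) {X : completeNormedModType R}.

Lemma bounded_finite_rank_lip0 (T : {linear X -> X}) :
  bounded_operator T -> finite_dimensional (range T) -> lip0_finite_rank X T.
Proof.
move=> [M TM] Tfin; split.
  apply/lip0P; split; last exact: linear0.
  exists `|M| => // x y; rewrite -linearB (le_trans (TM _))//.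
  by rewrite ler_wpM2r// ler_norm.
rewrite linear_span_id//; split; first by exists 0 => //; exact: linear0.
by move=> a _ _ [x _ <-] [y _ <-]; exists (a *: x + y) => //; rewrite linearP.
Qed.

(** The operators that are close to the identity on a p-compact set are
    Lipschitz of finite rank.  They generate a filter because p-compact sets are
    closed under finite unions, and this filter converges to the identity
    uniformly on p-compact sets. *)
Lemma lipschitz_p_approximation_of_linear : 1 <= p ->
  p_approximation_property p X -> lipschitz_p_approximation_property p X.
Proof.
move=> p1 XAP.
pose G : set_system (X -> X) := [set A | exists K (eps : R),
  [/\ p_compact p K, 0 < eps &
  [set f | lip0_finite_rank X f /\ forall x, K x -> `|f x - x| < eps] `<=` A]].
have GF : Filter G.
  split.
  - exists set0, 1; split => //; apply: p_compact0; exact: lt_le_trans p1.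
  - move=> A B [K [d [Kp d0 KA]]] [L [r [Lp r0 LB]]].
    exists (K `|` L), (Num.min d r); split; first exact: p_compactU.
      by rewrite lt_min d0.
    move=> f [ff fKL]; split.
      apply: KA; split => // x Kx.
      by have := fKL x (or_introl Kx); rewrite lt_min => /andP[].
    apply: LB; split => // x Lx.
    by have := fKL x (or_intror Lx); rewrite lt_min => /andP[].
  - move=> A B AB [K [d [Kp d0 KA]]]; exists K, d; split => //.
    exact: subset_trans AB.
have Gid : {family @p_compact R p X, G --> idfun}.
  apply/fam_cvgP => K Kp P /uniform_nbhs[U [+ UP]].
  rewrite -entourage_ballE => -[d /= d0 dU].
  exists K, d; split => //; apply: subset_trans UP => f [_ fK] x Kx /=.
  by apply: dU; rewrite /= -ball_normE /= distrC; exact: fK.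
move=> B /Gid[K [d [Kp d0 KB]]].
have [T [Tb Tf TK]] := XAP K d Kp d0.
have Tlip := bounded_finite_rank_lip0 Tb Tf.
by exists (T : X -> X); split => //; exact: KB.
Qed.

End LipschitzApproximation.

Theorem proposition3p12 (R : realType) (p : R) (X : completeNormedModType R)
    (hp : 1 <= p) :
  p_approximation_property p (LipschitzFree X) ->
  p_approximation_property p X /\ lipschitz_p_approximation_property p X.
Proof.
move=> FAP; have p0 : 0 <= p by exact: le_trans hp.
have [beta [beta1 betaK]] := barycenter_exists X.
have XAP := p_approximation_property_contraction beta1 (@delta_lipschitz R X)
  betaK p0 FAP.
by split=> //; exact: lipschitz_p_approximation_of_linear.
Qed.
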